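(* Let $J\subset\mathbb R$ be an interval, let $\alpha_1,\dots,\alpha_m\colon J\to\mathbb R$ be continuous functions linearly independent on $J$, let $A_1,\dots,A_m$ be pairwise commuting real constant $n\times n$ matrices, and let $B_j=A_j^{T}$. Let $\zeta\in\{1,\dots,m\}$ and assume: (i) $\nu^{0l}$, $l=1,\dots,r$, are linearly independent common real eigenvectors of the matrices $B_j$ corresponding to the eigenvalues $\lambda^{j}_l$, $l=1,\dots,r$, $j=1,\dots,m$; (ii) $\nu^{\theta l}$, $\theta=1,\dots,s_l-1$, are linearly independent real generalized eigenvectors (of order $\theta$) of the matrix $B_\zeta$ corresponding to the eigenvalue $\lambda^{\zeta}_l$ with elementary divisor of multiplicity $s_l$, $l=1,\dots,r$, and $\sum_{l=1}^{r}s_l\geq m+1$; (iii) denoting by $\Psi^{\zeta}_{\theta l}$, $\theta=1,\dots,s_l-1$, $l=1,\dots,r$, the functions determined on $\{x\colon\nu^{0l}x\neq0\}$ by $$\nu^{\theta l}x=\sum_{\rho=1}^{\theta}\binom{\theta-1}{\rho-1}\Psi^{\zeta}_{\rho l}(x)\,\nu^{\theta-\rho,\,l}x,\quad\theta=1,\dots,s_l-1,$$ none of the functions $\mathfrak a_j\Psi^{\zeta}_{\theta l}$, $j=1,\dots,m$, $j\neq\zeta$, $\theta=1,\dots,s_l-1$, $l=1,\dots,r$, is a nonconstant first integral of the system $\dfrac{dx}{dt}=A_\zeta x$ on any domain contained in $\{x\colon\nu^{0l}x\neq0\}$. Let $k\leq r$ and let $\varepsilon_1,\dots,\varepsilon_k$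 be non-negative integers with $\varepsilon_\xi\leq s_\xi-1$, $\xi=1,\dots,k$, and $\sum_{\xi=1}^{k}\varepsilon_\xi=m-k+1$. Let $\mu^{j\zeta}_{q\xi}$ denote the constant value (under these hypotheses) of $\mathfrak a_j\Psi^{\zeta}_{q\xi}$, $j=1,\dots,m$, $q=1,\dots,\varepsilon_\xi$, $\xi=1,\dots,k$, and let the real numbers $h_{q\xi}$, $q=0,\dots,\varepsilon_\xi$, $\xi=1,\dots,k$, be a nontrivial solution of the system $$\sum_{\xi=1}^{k}\Bigl(\lambda^{j}_\xi\,h_{0\xi}+\sum_{q=1}^{\varepsilon_\xi}\mu^{j\zeta}_{q\xi}\,h_{q\xi}\Bigr)=0,\quad j=1,\dots,m.$$ Then the function $$F\colon x\mapsto\prod_{\xi=1}^{k}(\nu^{0\xi}x)^{h_{0\xi}}\exp\sum_{q=1}^{\varepsilon_\xi}h_{q\xi}\,\Psi^{\zeta}_{q\xi}(x)\quad\text{for all }x\in\mathscr X,$$ where $\mathscr X\subset\mathbb R^n$ is any domain on which $F$ is defined and continuously differentiable, is an autonomous first integral of the (Lappo-Danilevskii) system $\dfrac{dx}{dt}=\sum_{j=1}^{m}\alpha_j(t)A_jx$.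
   Context: A domain is an open arcwise connected set. For a vector $\nu=(\nu_1,\dots,\nu_n)$ and $x\in\mathbb R^n$, $\nu x=\sum_{\xi=1}^n\nu_\xi x_\xi$; vectors are regarded as columns when multiplied by $B_j$. The operators are $\mathfrak a_j=\sum_{\xi=1}^n(A_jx)_\xi\,\partial_{x_\xi}$. Generalized eigenvectors $\nu^{\theta l}$ of order $\theta$ are non-zero vectors satisfying $(B_\zeta-\lambda^{\zeta}_lE)\nu^{\theta l}=\theta\,\nu^{\theta-1,\,l}$, $\theta=1,\dots,s_l-1$, $E$ the identity matrix. An autonomous first integral on $\mathscr X$ of $dx/dt=\sum_j\alpha_j(t)A_jx$ is a continuously differentiable function $F\colon\mathscr X\to\mathbb R$ with $\sum_{j=1}^m\alpha_j(t)\,\mathfrak a_jF(x)=0$ for all $(t,x)\in J\times\mathscr X$; a function $\Phi(x)$ of class $C^1$ is a first integral of $dx/dt=A_\zeta x$ if $\mathfrak a_\zeta\Phi=0$. *)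

(* Defs.v *)
From HB Require Import structures.
From mathcomp Require Import all_boot all_order all_algebra.
From mathcomp Require Import all_classical all_reals all_analysis.

Set Implicit Arguments.
Unset Strict Implicit.
Unset Printing Implicit Defensive.

Import Order.TTheory GRing.Theory Num.Theory.
Import numFieldNormedType.Exports.

Local Open Scope classical_set_scope.
Local Open Scope ring_scope.

Definition lin_indep_on (R : realType) (m : nat) (J : set R)
    (alpha : 'I_m -> R -> R) : Prop :=
  forall c : 'I_m -> R,
    (forall t, J t -> \sum_(j < m) c j * alpha j t = 0) -> forall j, c j = 0.

Definition dotv (R : realType) (n : nat) (nu x : 'cV[R]_n) : R :=
  \sum_(i < n) nu i 0 * x i 0.

Definition arcwise_connected (R : realType) (n : nat) (D : set 'cV[R]_n) : Prop :=
  forall x y, D x -> D y ->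
    exists gamma : R -> 'cV[R]_n,
      [/\ {within `[0%R, 1%R], continuous gamma}, gamma 0 = x, gamma 1 = y
        & forall t, 0 <= t <= 1 -> D (gamma t)].

Definition is_domain (R : realType) (n : nat) (D : set 'cV[R]_n) : Prop :=
  open D /\ arcwise_connected D.

Definition partial (R : realType) (n : nat) (i : 'I_n) (F : 'cV[R]_n -> R)
    : 'cV[R]_n -> R :=
  fun x => 'D_(delta_mx i 0) F x.

(* Only used for open D, so that partial derivatives and their continuity at
   the points of D depend only on the restriction of F to D. *)
Definition C1_on (R : realType) (n : nat) (D : set 'cV[R]_n)
    (F : 'cV[R]_n -> R) : Prop :=
  forall x, D x -> forall i : 'I_n,
    derivable F x (delta_mx i 0) /\ {for x, continuous (partial i F)}.

Definition lin_op (R : realType) (n : nat) (A : 'M[R]_n) (F : 'cV[R]_n -> R)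
    : 'cV[R]_n -> R :=
  fun x => \sum_(i < n) (A *m x) i 0 * partial i F x.

Definition first_integral (R : realType) (n : nat) (A : 'M[R]_n)
    (D : set 'cV[R]_n) (Phi : 'cV[R]_n -> R) : Prop :=
  C1_on D Phi /\ forall x, D x -> lin_op A Phi x = 0.

Definition nonconstant_on (R : realType) (n : nat) (D : set 'cV[R]_n)
    (Phi : 'cV[R]_n -> R) : Prop :=
  exists x y, [/\ D x, D y & Phi x <> Phi y].

Definition autonomous_first_integral (R : realType) (n m : nat) (J : set R)
    (alpha : 'I_m -> R -> R) (A : 'I_m -> 'M[R]_n)
    (X : set 'cV[R]_n) (F : 'cV[R]_n -> R) : Prop :=
  C1_on X F /\
  forall t x, J t -> X x -> \sum_(j < m) alpha j t * lin_op (A j) F x = 0.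

(* The gcd of the minors of order k of 'X - B.  All index maps are allowed:
   repeated indices only contribute zero minors, and reordered ones only
   change signs. *)
Definition det_divisor (R : realType) (n : nat) (B : 'M[R]_n) (k : nat)
    : {poly R} :=
  \big[@gcdp R/0]_(f : {ffun 'I_k -> 'I_n})
    \big[@gcdp R/0]_(g : {ffun 'I_k -> 'I_n})
      \det (mxsub f g (char_poly_mx B)).

Definition invariant_poly (R : realType) (n : nat) (B : 'M[R]_n) (k : nat)
    : {poly R} :=
  det_divisor B k.+1 %/ det_divisor B k.

(* ('X - a) ^+ s is one of the elementary divisors of B. *)
Definition elementary_divisor (R : realType) (n : nat) (B : 'M[R]_n)
    (a : R) (s : nat) : Prop :=
  (0 < s)%N /\ exists k : 'I_n, mup a (invariant_poly B k) = s.

(* The real power a ^ h, on the widest domain: a > 0 with any h, a = 0 with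
   h >= 0 (0 ^ 0 = 1), and a < 0 with h a rational of odd denominator (integers
   included), where (-1) ^ (p / q) = (-1) ^ p.  [rpow a h] is meaningful only
   when [rpow_defined a h]. *)
Definition rpow_defined (R : realType) (a h : R) : Prop :=
  [\/ 0 < a, a = 0 /\ 0 <= h
    | a < 0 /\ exists z : rat, h = ratr z /\ odd `|denq z|%N].

Definition rpow (R : realType) (a h : R) : R :=
  if 0 <= a then a `^ h
  else if `[< exists z : rat, h = ratr z /\ odd `|numq z|%N >]
       then - (`|a| `^ h) else `|a| `^ h.

(* Main.v *)
(* On {nu0 x <> 0} each Psi_th is a polynomial in linear forms and 1/(nu0 x).
   Applying a_zeta to the relation that defines Psi_th gives by induction
   a_zeta Psi_1 = 1 and a_zeta Psi_th = 0 for th > 1.  The operators a_j commute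
   because the A_j do, so a_zeta (a_j Psi_th) = a_j (a_zeta Psi_th) = 0, and (iii)
   makes a_j Psi_th constant on each of the two half-spaces; it takes the same
   value on both because Psi_th is even.

   Where no nu0 x vanishes, a_j F = F * sum (lam h_0 + sum mu h_q) = 0 by
   logarithmic differentiation.  These points are dense, and a_j F is continuous
   since F is C^1, so a_j F = 0 on the whole of X. *)
From HB Require Import structures.
Require Import Defs.
From mathcomp Require Import all_boot all_order all_algebra.
From mathcomp Require Import all_classical all_reals all_analysis.
From mathcomp Require Import ring zify.

Import Order.TTheory GRing.Theory Num.Theory.
Import numFieldNormedType.Exports.

Local Open Scope classical_set_scope.
Local Open Scope ring_scope.

Set Implicit Arguments.
Unset Strict Implicit.
Unset Printing Implicit Defensive.

(** * Linear forms, half-spaces and generic points *)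

Section LinearForms.
Variables (R : realType) (n : nat).
Implicit Types (c x y v : 'cV[R]_n) (A : 'M[R]_n).

Lemma dotvE c x : dotv c x = (c^T *m x) 0 0.
Proof. by rewrite mxE; apply: eq_bigr => i _; rewrite mxE. Qed.

Lemma dotv_is_linear c : linear (dotv c : 'cV[R]_n -> R^o).
Proof. by move=> a x y; rewrite !dotvE mulmxDr -scalemxAr !mxE. Qed.

HB.instance Definition _ c :=
  GRing.isLinear.Build R 'cV[R]_n R^o *:%R (dotv c) (dotv_is_linear c).

Lemma dotv_mulmx A c x : dotv c (A *m x) = dotv (A^T *m c) x.
Proof. by rewrite !dotvE trmx_mul trmxK mulmxA. Qed.

Lemma dotvZl a c x : dotv (a *: c) x = a * dotv c x.
Proof. by rewrite !dotvE linearZ /= -scalemxAl mxE. Qed.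

Lemma dotvDl c d x : dotv (c + d) x = dotv c x + dotv d x.
Proof. by rewrite !dotvE linearD /= mulmxDl mxE. Qed.

Lemma dotv_delta c i : dotv c (delta_mx i 0) = c i 0.
Proof.
rewrite /dotv (bigD1 i) //= big1 ?mxE ?eqxx ?mulr1 ?addr0 // => j ji.
by rewrite mxE (negbTE ji) mulr0.
Qed.

Lemma dotv_self_gt0 c : c != 0 -> 0 < dotv c c.
Proof.
move=> c0; rewrite lt_def; apply/andP; split; last first.
  by apply: sumr_ge0 => i _; rewrite -expr2 sqr_ge0.
apply: contra c0 => /eqP; rewrite /dotv => h; apply/eqP/matrixP => i j.
rewrite ord1 mxE; apply/eqP; rewrite -sqrf_eq0 expr2; apply/eqP.
by apply: (psumr_eq0P _ h) => // k _; rewrite -expr2 sqr_ge0.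
Qed.

Lemma differentiable_dotv c x : differentiable (dotv c) x.
Proof.
have -> : dotv c = \sum_i (fun y : 'cV[R]_n => c i 0 * y i 0).
  by apply/funext => y; rewrite fct_sumE.
apply: differentiable_sum => i.
by apply: differentiableM; [exact: differentiable_cst|exact: differentiable_coord].
Qed.

Lemma continuous_dotv c : continuous (dotv c).
Proof. by move=> x; apply/differentiable_continuous/differentiable_dotv. Qed.

Lemma diff_dotv c x v : 'd (dotv c) x v = dotv c v.
Proof. by rewrite diff_lin //; exact: continuous_dotv. Qed.

Lemma open_dotv_neq0 c : open [set x | dotv c x != 0].
Proof.
have -> : [set x | dotv c x != 0] = dotv c @^-1` [set t | t != 0] by [].
by apply: open_comp; [move=> x _; exact: continuous_dotv|exact: open_neq].
Qed.

(** Half-spaces are convex, so a segment joins any two points. They are the domains on which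
    hypothesis (iii) gets applied. *)
Lemma is_domain_halfspace c : is_domain [set x | 0 < dotv c x].
Proof.
split.
  have -> : [set x | 0 < dotv c x] = dotv c @^-1` [set t | 0 < t] by [].
  by apply: open_comp; [move=> x _; exact: continuous_dotv|exact: open_gt].
move=> x y /= x0 y0; exists (fun t : R => (1 - t) *: x + t *: y); split.
- apply: continuous_subspaceT => t.
  apply: cvgD; apply: cvgZr_tmp; last exact: cvg_id.
  by apply: cvgB; [exact: cvg_cst|exact: cvg_id].
- by rewrite subr0 scale1r scale0r addr0.
- by rewrite subrr scale1r scale0r add0r.
- move=> t /andP[t0 t1]; have -> : dotv c ((1 - t) *: x + t *: y) =
    (1 - t) * dotv c x + t * dotv c y by rewrite linearP linearZ.
  have : 0 <= (1 - t) * dotv c x by rewrite mulr_ge0 ?subr_ge0 // ltW.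
  have [->|tn0] := eqVneq t 0; first by rewrite subr0 !mul1r mul0r addr0.
  by move=> h; rewrite ltr_wpDl // mulr_gt0 // lt_def tn0.
Qed.

(** Finitely many hyperplanes cannot cover a nonempty open set: they are removed one at a time, each
    removal leaving a smaller open set that is still nonempty. *)
Lemma open_generic_point (s : seq 'cV[R]_n) (O : set 'cV[R]_n) x :
  (forall c, c \in s -> c != 0) -> open O -> O x ->
  exists y, O y /\ forall c, c \in s -> dotv c y != 0.
Proof.
elim: s O x => [|c s IH] O x s0 oO Ox; first by exists x.
have [y [Oy cy]] : exists y, O y /\ dotv c y != 0.
  have [cx|cx] := eqVneq (dotv c x) 0; last by exists x.
  (* From a point of the hyperplane, move along its normal: [dotv c (x + t *: c) = t * dotv c c] is
     nonzero for [t != 0], and small [t] keep the point in [O]. *)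
  have : \forall t \near (0 : R)^', O (x + t *: c).
    apply: cvg_within.
    have cvx : (fun t : R => x + t *: c) @ (0 : R) --> x.
      have -> : nbhs x = nbhs (x + 0 *: c) by rewrite scale0r addr0.
      by apply: cvgD; [exact: cvg_cst|apply: cvgZr_tmp; exact: cvg_id].
    by apply: cvx; exact: open_nbhs_nbhs.
  have : \forall t \near (0 : R)^', t != 0 by exact: nbhs_dnbhs_neq.
  move=> h1 h2.
  have [t [t0 Ot]] := filter_ex (filterI h1 h2).
  exists (x + t *: c); split => //.
  rewrite linearD linearZ /= cx add0r mulf_neq0 //.
  by rewrite gt_eqF // dotv_self_gt0 // s0 // mem_head.
have s0' d : d \in s -> d != 0 by move=> ds; apply: s0; rewrite inE ds orbT.
have oOc := openI oO (@open_dotv_neq0 c).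
have [z [[Oz cz] sz]] := IH _ y s0' oOc (conj Oy cy).
by exists z; split => // d; rewrite inE => /predU1P[->|/sz].
Qed.

End LinearForms.

(** * Calculus of the operators [lin_op] *)

Section LinOp.
Variables (R : realType) (n : nat).
Implicit Types (f g : 'cV[R]_n -> R) (A : 'M[R]_n) (x : 'cV[R]_n).

(** [lin_op] is total, so its value means something only together with the existence of the partial
    derivatives; carrying both lets the sum, product and chain rules compose. *)
Definition has_lin_op A f x d :=
  (forall i : 'I_n, derivable f x (delta_mx i 0)) /\ lin_op A f x = d.

Lemma near_has_lin_op A f g x d :
  (\near x, f x = g x) -> has_lin_op A f x d -> has_lin_op A g x d.
Proof.
move=> fg [df <-]; split; first by move=> i; exact: near_eq_derivable (df i).
by apply: eq_bigr => i _; rewrite /partial (near_eq_derive _ fg).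
Qed.

(** The operator is the derivative in the direction [A *m x], expanded in the standard basis. *)
Lemma differentiable_lin_op A f x :
  differentiable f x -> has_lin_op A f x ('d f x (A *m x)).
Proof.
move=> df; split=> [i|]; first exact: diff_derivable.
rewrite [in RHS](matrix_sum_delta (A *m x)) exchange_big big_ord1.
rewrite linear_sum; apply: eq_bigr => i _.
by rewrite linearZ /= /partial deriveE.
Qed.

Lemma has_lin_op_dotv A c x : has_lin_op A (dotv c) x (dotv (A^T *m c) x).
Proof.
rewrite -dotv_mulmx -(diff_dotv c x); apply: differentiable_lin_op.
exact: differentiable_dotv.
Qed.

Lemma has_lin_op_cst A a x : has_lin_op A (fun=> a) x 0.
Proof.
split=> [i|]; first exact: derivable_cst.
by apply: big1 => i _; rewrite /partial derive_cst mulr0.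
Qed.

Lemma has_lin_opD A f g x df dg :
  has_lin_op A f x df -> has_lin_op A g x dg ->
  has_lin_op A (fun y => f y + g y) x (df + dg).
Proof.
move=> [Df <-] [Dg <-]; split=> [i|]; first exact: derivableD.
rewrite /lin_op -big_split /=; apply: eq_bigr => i _.
by rewrite /partial (deriveD (Df i) (Dg i)) mulrDr.
Qed.

Lemma has_lin_opM A f g x df dg :
  has_lin_op A f x df -> has_lin_op A g x dg ->
  has_lin_op A (fun y => f y * g y) x (f x * dg + g x * df).
Proof.
move=> [Df <-] [Dg <-]; split=> [i|]; first exact: derivableM.
rewrite /lin_op !mulr_sumr -big_split /=; apply: eq_bigr => i _.
rewrite /partial (deriveM (Df i) (Dg i)) mulrDr.
by rewrite /(_ *: _) /= mulrCA [X in _ + X]mulrCA.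
Qed.

Lemma has_lin_op_sum A (I : eqType) (r : seq I) (F : I -> 'cV[R]_n -> R)
    (dF : I -> R) x :
  (forall i, i \in r -> has_lin_op A (F i) x (dF i)) ->
  has_lin_op A (fun y => \sum_(i <- r) F i y) x (\sum_(i <- r) dF i).
Proof.
elim: r => [|i r IH] dFE.
  under eq_fun do rewrite big_nil.
  by rewrite big_nil; exact: has_lin_op_cst.
under eq_fun do rewrite big_cons.
rewrite big_cons; apply: has_lin_opD; first by apply: dFE; exact: mem_head.
by apply: IH => j jr; apply: dFE; rewrite inE jr orbT.
Qed.

(** Leibniz rule in logarithmic form: [c i] plays the role of the logarithmic derivative of [F i] at
    [x], and these add up without dividing by any factor. *)
Lemma has_lin_op_prod A (I : finType) (P : pred I) (F : I -> 'cV[R]_n -> R)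
    (c : I -> R) x :
  (forall i, P i -> has_lin_op A (F i) x (c i * F i x)) ->
  has_lin_op A (fun y => \prod_(i | P i) F i y) x
    ((\sum_(i | P i) c i) * \prod_(i | P i) F i x).
Proof.
move=> FE; elim: (index_enum I) => [|i r IH].
  under eq_fun do rewrite big_nil.
  by rewrite !big_nil mul0r; exact: has_lin_op_cst.
under eq_fun do rewrite big_cons.
rewrite !big_cons; case: ifPn => // Pi.
have := has_lin_opM (FE _ Pi) IH; congr has_lin_op; ring.
Qed.

(** Restricting [f] to the line [h *: v + x] reduces this to the chain rule in one variable, so a
    directional derivative of [f] is enough. *)
Lemma is_derive_comp f (g : R -> R) x v df dg :
  is_derive x v f df -> is_derive (f x) 1 g dg ->
  is_derive x v (g \o f) (dg * df).
Proof.
move=> [fx <-] gx.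
have fline : is_derive (0 : R) 1 (fun h : R => f (h *: v + x)) ('D_v f x).
  split; first by apply/(derivable1P f x v).
  rewrite /derive; do 2 f_equal.
  apply/funext => h /=.
  by rewrite /shift /= addr0 scale0r add0r [h *: 1]mulr1.
have gline : is_derive (f ((0 : R) *: v + x)) 1 g dg.
  by rewrite scale0r add0r.
have [h1 h2] := is_derive1_comp gline fline.
split; first exact/derivable1P.
rewrite -h2 /derive; do 2 f_equal.
apply/funext => h /=.
by rewrite /shift /= addr0 scale0r add0r [h *: 1]mulr1.
Qed.

Lemma has_lin_op_comp A f (g : R -> R) x df dg :
  has_lin_op A f x df -> is_derive (f x) 1 g dg ->
  has_lin_op A (g \o f) x (dg * df).
Proof.
move=> [Df <-] gx.
have gf i := is_derive_comp (derivableP (Df i)) gx.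
split=> [i|]; first by case: (gf i).
rewrite /lin_op mulr_sumr; apply: eq_bigr => i _.
by rewrite /partial (@derive_val _ _ _ _ _ _ _ (gf i)) mulrCA.
Qed.

(** The sign from differentiating [- x] cancels the sign in [A *m (- x)], so the operator preserves
    evenness. *)
Lemma lin_op_opp A f x : (\near x, f (- x) = f x) ->
  differentiable f (- x) -> lin_op A f (- x) = lin_op A f x.
Proof.
move=> fN df.
have dN : differentiable (-%R : 'cV[R]_n -> 'cV[R]_n) x.
  exact: differentiableN.
have dfN : differentiable (f \o -%R) x.
  exact: differentiable_comp.
have [_ ->] := differentiable_lin_op A df.
have [_ ->] := near_has_lin_op fN (differentiable_lin_op A dfN).
have E : 'd (-%R : 'cV[R]_n -> 'cV[R]_n) x (A *m x) = A *m - x.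
  by rewrite diff_lin ?mulmxN //; exact: opp_continuous.
have := congr1 (fun h : 'cV[R]_n -> R => h (A *m x)) (diff_comp dN df).
by rewrite [RHS]/comp /= E => H; exact: esym H.
Qed.

End LinOp.

(* Polynomial expressions in linear forms and in the reciprocal of one fixed
   linear form: on such expressions derivations are syntactic, so the
   symmetry of second derivatives is an algebraic identity. *)
Inductive rexpr (R : realType) (n : nat) : Type :=
| Lin of 'cV[R]_n
| Cst of R
| Inv
| Add of rexpr R n & rexpr R n
| Mul of rexpr R n & rexpr R n.

Arguments Cst {R n}.
Arguments Inv {R n}.

(** * Rational expressions in linear forms and their derivations *)

Section RationalExpr.
Variables (R : realType) (n : nat) (c0 : 'cV[R]_n).
Implicit Types (e : rexpr R n) (x v : 'cV[R]_n) (d : 'cV[R]_n -> rexpr R n).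

Fixpoint reval e x : R :=
  match e with
  | Lin c => dotv c x
  | Cst a => a
  | Inv => (dotv c0 x)^-1
  | Add e1 e2 => reval e1 x + reval e2 x
  | Mul e1 e2 => reval e1 x * reval e2 x
  end.

(* The derivation extending [d] on the linear forms. *)
Fixpoint rder d e : rexpr R n :=
  match e with
  | Lin c => d c
  | Cst _ => Cst 0
  | Inv => Mul (Cst (-1)) (Mul (Mul Inv Inv) (d c0))
  | Add e1 e2 => Add (rder d e1) (rder d e2)
  | Mul e1 e2 => Add (Mul e1 (rder d e2)) (Mul e2 (rder d e1))
  end.

Definition rder_partial (i : 'I_n) : rexpr R n -> rexpr R n :=
  rder (fun c => Cst (c i 0)).

(** The form [dotv c] is sent to [x |-> dotv c (A *m x)], which is the form of [A^T *m c]. *)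
Definition rder_lin (A : 'M[R]_n) : rexpr R n -> rexpr R n :=
  rder (fun c => Lin (A^T *m c)).

(** The commutator of two derivations is a derivation, so it vanishes once it vanishes on the linear
    forms. *)
Lemma rder_comm d1 d2 x :
  (forall c, reval (rder d1 (d2 c)) x = reval (rder d2 (d1 c)) x) ->
  forall e, reval (rder d1 (rder d2 e)) x = reval (rder d2 (rder d1 e)) x.
Proof.
move=> d12; elim=> [c|a||e1 IH1 e2 IH2|e1 IH1 e2 IH2] //=.
- by rewrite d12; ring.
- by rewrite IH1 IH2.
- by rewrite IH1 IH2; ring.
Qed.

Lemma rder_lin_comm (A B : 'M[R]_n) e x : comm_mx A B ->
  reval (rder_lin A (rder_lin B e)) x = reval (rder_lin B (rder_lin A e)) x.
Proof.
move=> AB; apply: rder_comm => c /=.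
by rewrite !mulmxA -!trmx_mul AB.
Qed.

Lemma differentiable_reval e x : dotv c0 x != 0 -> differentiable (reval e) x.
Proof.
move=> x0; elim: e => [c|a||e1 IH1 e2 IH2|e1 IH1 e2 IH2] /=.
- exact: differentiable_dotv.
- exact: differentiable_cst.
- exact: (differentiableV (differentiable_dotv c0 x) x0).
- exact: differentiableD.
- exact: differentiableM.
Qed.

(** Leaving [d] and [v] free serves both cases: [v] a basis vector gives [rder_partial], and
    [v = A *m x] gives [rder_lin]. *)
Lemma diff_reval d e x v : dotv c0 x != 0 ->
  (forall c, reval (d c) x = dotv c v) ->
  'd (reval e) x v = reval (rder d e) x.
Proof.
move=> x0 dv; elim: e => [c|a||e1 IH1 e2 IH2|e1 IH1 e2 IH2] /=.
- by rewrite dv diff_dotv.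
- by rewrite (diff_cst a x).
- have := congr1 (fun h : 'cV[R]_n -> R => h v)
    (diffV (differentiable_dotv c0 x) x0).
  move=> /= ->; rewrite diff_dotv dv -exprVn expr2 mulN1r.
  exact: mulNr.
- have := congr1 (fun h : 'cV[R]_n -> R => h v)
    (diffD (differentiable_reval e1 x0) (differentiable_reval e2 x0)).
  by move=> /= H; rewrite -IH1 -IH2; exact: H.
- have := congr1 (fun h : 'cV[R]_n -> R => h v)
    (diffM (differentiable_reval e1 x0) (differentiable_reval e2 x0)).
  by move=> /= H; rewrite -IH1 -IH2; exact: H.
Qed.

Lemma has_lin_op_reval A e x : dotv c0 x != 0 ->
  has_lin_op A (reval e) x (reval (rder_lin A e) x).
Proof.
move=> x0; rewrite -(@diff_reval _ _ _ (A *m x)) //.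
  by apply: differentiable_lin_op; exact: differentiable_reval.
by move=> c /=; rewrite dotv_mulmx.
Qed.

Lemma partial_reval i e x : dotv c0 x != 0 ->
  partial i (reval e) x = reval (rder_partial i e) x.
Proof.
move=> x0; rewrite -(@diff_reval _ _ _ (delta_mx i 0)) //.
  by rewrite /partial deriveE //; exact: differentiable_reval.
by move=> c; rewrite dotv_delta.
Qed.

Lemma near_dotv_neq0 x : dotv c0 x != 0 -> \near x, dotv c0 x != 0.
Proof.
by move=> x0; apply: open_nbhs_nbhs; split; first exact: open_dotv_neq0.
Qed.

(** The partial derivatives are again expressions of the same kind, hence continuous off the
    hyperplane. *)
Lemma C1_on_reval e : C1_on [set x | dotv c0 x != 0] (reval e).
Proof.
move=> x x0 i; split; first exact/diff_derivable/differentiable_reval.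
rewrite /prop_for /continuous_at partial_reval //.
apply: cvg_trans (differentiable_continuous
  (differentiable_reval (rder_partial i e) x0)).
apply: (@near_eq_cvg _ _ (nbhs x)); apply: filterS (near_dotv_neq0 x0) => y y0.
by rewrite partial_reval.
Qed.

(** Agreement is asked only off the hyperplane because [Psi] is specified only there; its values on
    the hyperplane are arbitrary. *)
Definition rational_form (f : 'cV[R]_n -> R) :=
  exists e, forall x, dotv c0 x != 0 -> f x = reval e x.

Lemma rational_form_near f e x : (forall x, dotv c0 x != 0 -> f x = reval e x) ->
  dotv c0 x != 0 -> \near x, reval e x = f x.
Proof.
by move=> fe x0; apply: filterS (near_dotv_neq0 x0) => y y0; rewrite fe.
Qed.

Lemma rational_form_lin_op A f : rational_form f -> rational_form (lin_op A f).
Proof.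
move=> [e fe]; exists (rder_lin A e) => x x0.
by have [_ ->] := near_has_lin_op (rational_form_near fe x0) (has_lin_op_reval A e x0).
Qed.

Lemma rational_form_has_lin_op A f x : rational_form f -> dotv c0 x != 0 ->
  has_lin_op A f x (lin_op A f x).
Proof.
move=> [e fe] x0.
have := near_has_lin_op (rational_form_near fe x0) (has_lin_op_reval A e x0).
by move=> [].
Qed.

Lemma rational_form_lin_op_comm A B f x : comm_mx A B -> rational_form f ->
  dotv c0 x != 0 -> lin_op A (lin_op B f) x = lin_op B (lin_op A f) x.
Proof.
move=> AB [e fe] x0.
have lfe C y : dotv c0 y != 0 -> lin_op C f y = reval (rder_lin C e) y.
  move=> y0; have [_ ->] // :=
    near_has_lin_op (rational_form_near fe y0) (has_lin_op_reval C e y0).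
have [_ ->] := near_has_lin_op (rational_form_near (lfe B) x0)
  (has_lin_op_reval A _ x0).
have [_ ->] := near_has_lin_op (rational_form_near (lfe A) x0)
  (has_lin_op_reval B _ x0).
exact: rder_lin_comm.
Qed.

Lemma C1_on_near D f g : (forall x, D x -> \near x, f x = g x) ->
  C1_on D f -> C1_on D g.
Proof.
move=> fg fC x Dx i; have [df cf] := fC x Dx i; split.
  exact: near_eq_derivable (fg x Dx) df.
rewrite /prop_for /continuous_at /partial -(near_eq_derive _ (fg x Dx)).
apply: cvg_trans cf; apply: (@near_eq_cvg _ _ (nbhs x)).
(* Agreement near [x] is also agreement near every [y] close to [x], so the partial derivatives
   agree around [x] as well. *)
have := near_join (fg x Dx); apply: filterS => y fgy.
by rewrite /partial (near_eq_derive _ fgy).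
Qed.

Lemma C1_on_rational_form D f : D `<=` [set x | dotv c0 x != 0] ->
  rational_form f -> C1_on D f.
Proof.
move=> Dc0 [e fe]; apply: (@C1_on_near _ (reval e)) => x Dx.
  exact: rational_form_near fe (Dc0 x Dx).
exact: C1_on_reval (Dc0 x Dx).
Qed.

Lemma rational_form_opp_lin_op A f x : rational_form f ->
  (forall x, dotv c0 x != 0 -> f (- x) = f x) ->
  dotv c0 x != 0 -> lin_op A f (- x) = lin_op A f x.
Proof.
move=> [e fe] fN x0.
have xN0 : dotv c0 (- x) != 0 by rewrite linearN oppr_eq0.
have [_ ->] := near_has_lin_op (rational_form_near fe x0) (has_lin_op_reval A e x0).
have [_ <-] := (has_lin_op_reval A e x0).
have [_ ->] := near_has_lin_op (rational_form_near fe xN0) (has_lin_op_reval A e xN0).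
have [_ <-] := (has_lin_op_reval A e xN0).
apply: lin_op_opp; last exact: differentiable_reval.
apply: filterS (near_dotv_neq0 x0) => y y0.
by rewrite -!fe ?fN // linearN oppr_eq0.
Qed.

Lemma rational_form_dotv c : rational_form (dotv c).
Proof. by exists (Lin c). Qed.

Lemma rational_form_inv : rational_form (fun x => (dotv c0 x)^-1).
Proof. by exists Inv. Qed.

Lemma rational_formD f g : rational_form f -> rational_form g ->
  rational_form (fun x => f x + g x).
Proof.
by move=> [e fe] [e' ge]; exists (Add e e') => x x0 /=; rewrite fe ?ge.
Qed.

Lemma rational_formM f g : rational_form f -> rational_form g ->
  rational_form (fun x => f x * g x).
Proof.
by move=> [e fe] [e' ge]; exists (Mul e e') => x x0 /=; rewrite fe ?ge.
Qed.

Lemma rational_formZ a f : rational_form f -> rational_form (fun x => a * f x).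
Proof. by apply: rational_formM; exists (Cst a). Qed.

Lemma rational_form_sum (I : eqType) (r : seq I) (F : I -> 'cV[R]_n -> R) :
  (forall i, i \in r -> rational_form (F i)) ->
  rational_form (fun x => \sum_(i <- r) F i x).
Proof.
elim: r => [|i r IH] rF.
  by exists (Cst 0) => x _; rewrite big_nil.
under eq_fun do rewrite big_cons.
apply: rational_formD; first by apply: rF; exact: mem_head.
by apply: IH => j jr; apply: rF; rewrite inE jr orbT.
Qed.

End RationalExpr.

(** * The functions [Psi] attached to one chain of generalized eigenvectors *)

Section GeneralizedEigenvectors.
Variables (R : realType) (n : nat) (s : nat).
Variables (nu : nat -> 'cV[R]_n) (Psi : nat -> 'cV[R]_n -> R).
Hypothesis Psi_def : forall th x, (0 < th < s)%N -> dotv (nu 0%N) x != 0 ->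
  dotv (nu th) x =
    \sum_(1 <= rho < th.+1)
      'C(th.-1, rho.-1)%:R * Psi rho x * dotv (nu (th - rho)%N) x.

(** The term [rho = th] of the defining relation is [Psi th x * dotv (nu 0) x]; solving for it gives
    a recursion suited to strong induction. *)
Lemma PsiE th x : (0 < th < s)%N -> dotv (nu 0%N) x != 0 ->
  Psi th x = (dotv (nu th) x -
    \sum_(1 <= rho < th)
      'C(th.-1, rho.-1)%:R * Psi rho x * dotv (nu (th - rho)%N) x)
    * (dotv (nu 0%N) x)^-1.
Proof.
move=> ths x0; have /andP[th0 _] := ths.
rewrite Psi_def // big_nat_recr //= binn subnn mul1r addrAC subrr add0r.
by rewrite mulfK.
Qed.

Lemma rational_form_Psi th :
  (0 < th < s)%N -> rational_form (nu 0%N) (Psi th).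
Proof.
elim/ltn_ind: th => th IH ths.
pose f x := (dotv (nu th) x +
  (-1) * (\sum_(rho <- index_iota 1 th)
      ('C(th.-1, rho.-1)%:R * Psi rho x) * dotv (nu (th - rho)%N) x))
    * (dotv (nu 0%N) x)^-1.
have [e fe] : rational_form (nu 0%N) f.
  apply: rational_formM; last exact: rational_form_inv.
  apply: rational_formD; first exact: rational_form_dotv.
  apply/rational_formZ/rational_form_sum => rho; rewrite mem_index_iota => rhoth.
  apply: rational_formM; last exact: rational_form_dotv.
  by apply/rational_formZ/IH; lia.
by exists e => x x0; rewrite -fe // /f mulN1r PsiE.
Qed.

(** In [PsiE] the numerator is odd, by induction, and so is the denominator. *)
Lemma Psi_even th x : (0 < th < s)%N -> dotv (nu 0%N) x != 0 ->
  Psi th (- x) = Psi th x.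
Proof.
elim/ltn_ind: th => th IH ths x0.
have xN0 : dotv (nu 0%N) (- x) != 0 by rewrite linearN oppr_eq0.
rewrite (PsiE ths x0) (PsiE ths xN0).
have -> : \sum_(1 <= rho < th)
    'C(th.-1, rho.-1)%:R * Psi rho (- x) * dotv (nu (th - rho)%N) (- x) =
  - \sum_(1 <= rho < th)
    'C(th.-1, rho.-1)%:R * Psi rho x * dotv (nu (th - rho)%N) x.
  rewrite -sumrN big_nat [in RHS]big_nat; apply: eq_bigr => rho rhoth.
  by rewrite linearN mulrN IH //; lia.
by rewrite !linearN -opprD invrN mulrNN.
Qed.

Section Constant.
Variables (A : 'M[R]_n) (lam : R).
Hypothesis nu0_eigen : A^T *m nu 0%N = lam *: nu 0%N.
Hypothesis nu_eigen : forall th, (0 < th < s)%N ->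
  (A^T - lam%:M) *m nu th = th%:R *: nu th.-1.

(** At [th = 0] the second term has coefficient 0, so one formula covers the eigenvector and the
    generalized eigenvectors. *)
Lemma lin_op_dotv_nu th x : (th < s)%N || (th == 0%N) ->
  has_lin_op A (dotv (nu th)) x
    (lam * dotv (nu th) x + th%:R * dotv (nu th.-1) x).
Proof.
move=> ths.
suff -> : lam * dotv (nu th) x + th%:R * dotv (nu th.-1) x =
  dotv (A^T *m nu th) x by exact: has_lin_op_dotv.
case: th ths => [|th] ths.
  by rewrite nu0_eigen dotvZl mul0r addr0.
have /nu_eigen : (0 < th.+1 < s)%N by rewrite orbF in ths.
rewrite mulmxBl mul_scalar_mx => /eqP.
by rewrite subr_eq => /eqP ->; rewrite dotvDl !dotvZl addrC.
Qed.

(** The form of [nu th] is differentiated twice over: through the eigenvector relation and by the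
    Leibniz rule in the defining relation. The [lam] terms cancel, and the terms where the operator
    lowers [nu] account for [th.-1] of the [th] copies of [dotv (nu th.-1) x]. *)
Lemma lin_op_Psi th x : (0 < th < s)%N -> dotv (nu 0%N) x != 0 ->
  lin_op A (Psi th) x = (th == 1%N)%:R.
Proof.
elim/ltn_ind: th => th IH ths x0; have /andP[th0 ths'] := ths.
have h1 := lin_op_dotv_nu x (introT orP (or_introl ths')).
have h2 : has_lin_op A (dotv (nu th)) x
  (\sum_(rho <- index_iota 1 th.+1)
    ('C(th.-1, rho.-1)%:R * Psi rho x *
       (lam * dotv (nu (th - rho)%N) x +
          (th - rho)%:R * dotv (nu (th - rho).-1) x) +
     dotv (nu (th - rho)%N) x * ('C(th.-1, rho.-1)%:R * lin_op A (Psi rho) x))).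
  apply: (near_has_lin_op (f := fun y => \sum_(rho <- index_iota 1 th.+1)
    ('C(th.-1, rho.-1)%:R * Psi rho y) * dotv (nu (th - rho)%N) y)).
    by apply: filterS (near_dotv_neq0 x0) => y y0; rewrite -Psi_def.
  apply: has_lin_op_sum => rho; rewrite mem_index_iota => rhoth.
  apply: has_lin_opM; last by apply: lin_op_dotv_nu; lia.
  rewrite -[X in has_lin_op _ _ _ X]addr0 -[X in _ + X](mulr0 (Psi rho x)).
  apply: has_lin_opM; first exact: has_lin_op_cst.
  by apply: (rational_form_has_lin_op A (rational_form_Psi _) x0); lia.
have := etrans (esym h1.2) h2.2.
under eq_bigr do rewrite mulrDr -addrA.
rewrite big_split /=.
have -> : \sum_(rho <- index_iota 1 th.+1) 'C(th.-1, rho.-1)%:R * Psi rho x *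
     (lam * dotv (nu (th - rho)%N) x) = lam * dotv (nu th) x.
  by rewrite Psi_def // mulr_sumr; apply: eq_bigr => rho _; ring.
move=> /addrI; rewrite big_split /=.
(* [C(th-1, rho-1) (th-rho) = (th-1) C(th-2, rho-1)] turns the second sum into
   the defining relation of order [th - 1]. *)
have -> : \sum_(rho <- index_iota 1 th.+1) 'C(th.-1, rho.-1)%:R * Psi rho x *
     ((th - rho)%:R * dotv (nu (th - rho).-1) x) = th.-1%:R * dotv (nu th.-1) x.
  rewrite big_nat_recr //= subnn mul0r mulr0 addr0.
  have [->|th1] := eqVneq th 1%N; first by rewrite big_nil mul0r.
  rewrite (@Psi_def th.-1) //; last by lia.
  rewrite prednK ?mulr_sumr; last by lia.
  rewrite big_nat [in RHS]big_nat; apply: eq_bigr => rho rhoth.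
  have -> : (th - rho).-1 = (th.-1 - rho)%N by lia.
  have bE : ('C(th.-1, rho.-1) * (th - rho) = th.-1 * 'C(th.-2, rho.-1))%N.
    have := mul_bin_down th.-1 rho.-1.
    have -> : (th.-1 - rho.-1 = th - rho)%N by lia.
    by move=> ->; rewrite mulnC.
  by rewrite mulrA -[_ * _ * (_)%:R]mulrAC -natrM bE natrM; ring.
(* One copy of [dotv (nu th.-1) x] is left, equal to the sum of the terms in which some [Psi rho] is
   differentiated. *)
have thE : th%:R = th.-1%:R + 1 :> R by rewrite natr1 prednK.
rewrite thE mulrDl mul1r => /addrI.
have [->|th1] := eqVneq th 1%N.
  rewrite big_nat1 subnn /= bin0 mul1r => /eqP.
  by rewrite -[X in X == _]mulr1 => /eqP/(mulfI x0).
(* By induction the term [rho = 1] equals the remaining copy and the terms with [1 < rho < th]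
   vanish, which leaves [dotv (nu 0) x * lin_op A (Psi th) x = 0]. *)
rewrite big_nat_recr //= subnn binn mul1r big_ltn; last by lia.
rewrite bin0 mul1r IH ?eqxx ?mulr1 ?subn1; try lia.
rewrite big_nat big1 => [|rho rhoth]; last first.
  by rewrite IH ?mulr0; [case: eqP => [|_]|lia..]; [lia|rewrite !mulr0].
rewrite addr0 -[X in X = _]addr0 => /addrI/eqP.
by rewrite eq_sym mulf_eq0 (negbTE x0) => /eqP.
Qed.

(** The base point [nu 0] lies in the positive half-space because [dotv (nu 0) (nu 0) > 0]. For
    [B = A] the value is known from [lin_op_Psi]; otherwise a second value on that half-space would
    contradict [noint]. *)
Lemma lin_op_Psi_constant (B : 'M[R]_n) th x :
  nu 0%N != 0 -> comm_mx A B -> (0 < th < s)%N ->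
  (B != A -> forall D, is_domain D ->
    D `<=` [set x | dotv (nu 0%N) x != 0] ->
    ~ (first_integral A D (lin_op B (Psi th)) /\
       nonconstant_on D (lin_op B (Psi th)))) ->
  dotv (nu 0%N) x != 0 -> lin_op B (Psi th) x = lin_op B (Psi th) (nu 0%N).
Proof.
move=> nu0 AB ths noint x0; have nu00 := dotv_self_gt0 nu0.
have [->|BA] := eqVneq B A; first by rewrite !lin_op_Psi // gt_eqF.
have pos y : 0 < dotv (nu 0%N) y ->
    lin_op B (Psi th) y = lin_op B (Psi th) (nu 0%N).
  move=> y0; apply: contrapT => yne.
  have sub : [set x | 0 < dotv (nu 0%N) x] `<=` [set x | dotv (nu 0%N) x != 0].
    by move=> z /= z0; rewrite gt_eqF.
  apply: (noint BA _ (is_domain_halfspace (nu 0%N)) sub).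
  split; last by exists y, (nu 0%N).
  split.
    exact: C1_on_rational_form sub (rational_form_lin_op B (rational_form_Psi ths)).
  move=> z /sub /= z0.
  rewrite (rational_form_lin_op_comm AB (rational_form_Psi ths)) //.
  (* After commuting the operators, [lin_op A (Psi th)] is locally constant, so [lin_op B] kills
     it. *)
  suff [] : has_lin_op B (lin_op A (Psi th)) z 0 by [].
  apply: near_has_lin_op (has_lin_op_cst B (th == 1%N)%:R z).
  by apply: filterS (near_dotv_neq0 z0) => t t0; rewrite lin_op_Psi.
have [x0'|] := ltP 0 (dotv (nu 0%N) x); first exact: pos.
rewrite le_eqVlt (negbTE x0) /= => xlt.
(* A point of the negative half-space is reflected into the positive one. *)
rewrite -(rational_form_opp_lin_op B (rational_form_Psi ths)) //; last first.
  by move=> y y0; exact: Psi_even.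
by apply: pos; rewrite linearN oppr_gt0.
Qed.

End Constant.
End GeneralizedEigenvectors.

(** * Real powers, and passage from generic points to the whole domain *)

Lemma is_derive_rpow (R : realType) (a h : R) : a != 0 ->
  is_derive a 1 (@rpow R ^~ h) (h * rpow a h / a).
Proof.
move=> a0; have [apos|] := ltP 0 a.
  have eq_pow : \near a, a `^ h = rpow a h.
    by apply: filterS (lt_nbhsr apos) => b b0; rewrite /rpow (ltW b0).
  have := near_eq_is_derive eq_pow (is_derive1_powR h apos).
  congr (is_derive _ _ _ _).
  rewrite /rpow (ltW apos) -mulrA; congr (_ * _).
  by rewrite powRB ?a0 ?implybT // powRr1 ?ltW.
rewrite le_eqVlt (negbTE a0) /= => aneg.
pose sg : R := if `[< exists z : rat, h = ratr z /\ odd `|numq z|%N >] then -1 else 1.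
have rpowE b : b < 0 -> rpow b h = sg * (- b) `^ h.
  move=> b0; rewrite /rpow leNgt b0 /= ltr0_norm // /sg.
  by case: ifP; rewrite ?mulN1r ?mul1r.
have eq_pow : \near a, sg * (- a) `^ h = rpow a h.
  by apply: filterS (lt_nbhsl aneg) => b b0; rewrite rpowE.
have Na : 0 < - a by rewrite oppr_gt0.
apply: (near_eq_is_derive eq_pow).
have dN : is_derive a 1 (-%R : R -> R) (-1) by exact: is_deriveNid.
have := is_derive1_comp (is_derive1_powR h Na) dN => dp.
have := is_deriveZ sg dp.
congr (is_derive _ _ _ _).
rewrite rpowE // powRB ?oppr_eq0 ?a0 ?implybT // powRr1 ?ltW // invrN.
by rewrite /(_ *: _) /=; ring.
Qed.

Lemma cvg_lin_op (R : realType) (n : nat) (A : 'M[R]_n)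
    (D : set 'cV[R]_n) (F : 'cV[R]_n -> R) x :
  C1_on D F -> D x -> lin_op A F y @[y --> x] --> lin_op A F x.
Proof.
move=> FC Dx; rewrite /lin_op.
elim: (index_enum 'I_n) => [|i r IH].
  rewrite big_nil.
  have -> : (fun y : 'cV[R]_n => \sum_(i <- [::]) (A *m y) i 0 * partial i F y)
    = cst 0 by apply/funext => y; rewrite big_nil.
  exact: (@cvg_cst _ _ _ (nbhs x)).
rewrite big_cons.
have -> : (fun y : 'cV[R]_n => \sum_(i <- i :: r) (A *m y) i 0 * partial i F y)
  = (fun y => (A *m y) i 0 * partial i F y +
      \sum_(i <- r) (A *m y) i 0 * partial i F y).
  by apply/funext => y; rewrite big_cons.
apply: cvgD IH; apply: cvgM; last by case: (FC x Dx i).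
(* The coefficient is the linear form given by row [i] of [A], hence continuous. *)
have E y : (A *m y) i 0 = dotv (row i A)^T y by rewrite dotvE trmxK -row_mul [RHS]mxE.
rewrite E (_ : (fun y : 'cV[R]_n => (A *m y) i 0) = dotv (row i A)^T).
  exact: continuous_dotv.
exact/funext.
Qed.

(** If the continuous function [lin_op A F] were nonzero at [x], it would be nonzero on a
    neighbourhood of [x] in [D], and that contains a generic point. *)
Lemma lin_op_eq0_generic (R : realType) (n : nat) (A : 'M[R]_n)
    (D : set 'cV[R]_n) (F : 'cV[R]_n -> R) (s : seq 'cV[R]_n) x :
  open D -> C1_on D F -> (forall c, c \in s -> c != 0) ->
  (forall y, D y -> (forall c, c \in s -> dotv c y != 0) -> lin_op A F y = 0) ->
  D x -> lin_op A F x = 0.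
Proof.
move=> oD FC s0 F0 Dx; apply: contrapT => /eqP Fx.
have nFx : nbhs x [set y | lin_op A F y != 0].
  have /(cvg_lin_op FC Dx) : nbhs (lin_op A F x) [set t : R | t != 0].
    by apply: open_nbhs_nbhs; split; first exact: open_neq.
  by [].
have : nbhs x (D `&` [set y | lin_op A F y != 0]).
  by apply: filterI => //; exact: open_nbhs_nbhs.
rewrite nbhsE; case=> O [oO Ox] OD.
have [y [Oy sy]] := open_generic_point s0 oO Ox.
have [Dy /eqP Fy] := OD _ Oy.
by apply: Fy; exact: F0.
Qed.

(** The form of an eigenvector is an eigenfunction of the operator, so its power [h] is one with
    eigenvalue [lam * h]. *)
Lemma has_lin_op_rpow_dotv (R : realType) (n : nat) (A : 'M[R]_n)
    (c : 'cV[R]_n) (lam h : R) x :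
  A^T *m c = lam *: c -> dotv c x != 0 ->
  has_lin_op A (fun y => rpow (dotv c y) h) x (lam * h * rpow (dotv c x) h).
Proof.
move=> cA x0.
have := has_lin_op_comp (has_lin_op_dotv A c x) (is_derive_rpow h x0).
congr has_lin_op; rewrite cA dotvZl.
by field.
Qed.

(** * The first integral *)

Theorem theorem2p11 (R : realType) (n m r : nat)
  (J : set R) (alpha : 'I_m -> R -> R) (A : 'I_m -> 'M[R]_n)
  (zeta : 'I_m)
  (nu : nat -> 'I_r -> 'cV[R]_n) (lam : 'I_m -> 'I_r -> R) (s : 'I_r -> nat)
  (Psi : nat -> 'I_r -> 'cV[R]_n -> R)
  (J_interval : is_interval J)
  (alpha_continuous : forall j, {within J, continuous (alpha j)})
  (alpha_indep : lin_indep_on J alpha)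
  (A_comm : forall i j, comm_mx (A i) (A j))
  (* (i) *)
  (nu0_free : free [seq nu 0%N l | l <- enum 'I_r])
  (nu0_eigen : forall j l,
     nu 0%N l != 0 /\ (A j)^T *m nu 0%N l = lam j l *: nu 0%N l)
  (* (ii) *)
  (nu_free : free [seq nu th l | l <- enum 'I_r, th <- iota 1 (s l).-1])
  (nu_gen_eigen : forall l th, (0 < th < s l)%N ->
     nu th l != 0 /\
     ((A zeta)^T - (lam zeta l)%:M) *m nu th l = th%:R *: nu th.-1 l)
  (s_divisor : forall l, elementary_divisor (A zeta)^T (lam zeta l) (s l))
  (s_sum : (m.+1 <= \sum_(l < r) s l)%N)
  (* (iii) *)
  (Psi_def : forall l th x, (0 < th < s l)%N -> dotv (nu 0%N l) x != 0 ->
     dotv (nu th l) x =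
       \sum_(1 <= rho < th.+1)
         'C(th.-1, rho.-1)%:R * Psi rho l x * dotv (nu (th - rho)%N l) x)
  (Psi_no_integral : forall (j : 'I_m) l th (D : set 'cV[R]_n),
     j != zeta -> (0 < th < s l)%N ->
     is_domain D -> D `<=` [set x | dotv (nu 0%N l) x != 0] ->
     ~ (first_integral (A zeta) D (lin_op (A j) (Psi th l)) /\
        nonconstant_on D (lin_op (A j) (Psi th l))))
  (* indices xi < k stand for xi = 1, ..., k *)
  (k : nat) (eps : 'I_r -> nat)
  (k_le : (k <= r)%N)
  (eps_le : forall xi : 'I_r, (xi < k)%N -> (eps xi <= s xi - 1)%N)
  (eps_sum : (\sum_(xi < r | (xi < k)%N) eps xi + k = m.+1)%N) :
  exists mu : 'I_m -> nat -> 'I_r -> R,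
    (forall j q (xi : 'I_r) x, (xi < k)%N -> (1 <= q <= eps xi)%N ->
       dotv (nu 0%N xi) x != 0 -> lin_op (A j) (Psi q xi) x = mu j q xi) /\
    forall (h : nat -> 'I_r -> R) (X : set 'cV[R]_n),
      (exists q (xi : 'I_r), [/\ (xi < k)%N, (q <= eps xi)%N & h q xi != 0]) ->
      (forall j, \sum_(xi < r | (xi < k)%N)
         (lam j xi * h 0%N xi +
          \sum_(1 <= q < (eps xi).+1) mu j q xi * h q xi) = 0) ->
      let F := fun x : 'cV[R]_n =>
        \prod_(xi < r | (xi < k)%N)
          (rpow (dotv (nu 0%N xi) x) (h 0%N xi) *
           expR (\sum_(1 <= q < (eps xi).+1) h q xi * Psi q xi x)) in
      is_domain X ->
      (* F is defined on X *)
      (forall x (xi : 'I_r), X x -> (xi < k)%N ->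
         rpow_defined (dotv (nu 0%N xi) x) (h 0%N xi) /\
         ((exists2 q, (1 <= q <= eps xi)%N & h q xi != 0) ->
          dotv (nu 0%N xi) x != 0)) ->
      C1_on X F ->
      autonomous_first_integral J alpha A X F.

Proof.
(* The constant is read off at the point [nu 0 xi], which lies off its own hyperplane. *)
exists (fun j q xi => lin_op (A j) (Psi q xi) (nu 0%N xi)).
have ltS (xi : 'I_r) q : (xi < k)%N -> (1 <= q <= eps xi)%N -> (0 < q < s xi)%N.
  by move=> xik qeps; have := eps_le xi xik; lia.
have muE j q (xi : 'I_r) x : (xi < k)%N -> (1 <= q <= eps xi)%N ->
    dotv (nu 0%N xi) x != 0 ->
    lin_op (A j) (Psi q xi) x = lin_op (A j) (Psi q xi) (nu 0%N xi).
  move=> xik qeps x0; have qs := ltS _ _ xik qeps.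
  apply: (@lin_op_Psi_constant _ _ (s xi) (nu^~ xi) (Psi^~ xi) _ (A zeta)
    (lam zeta xi)) => //.
  - by move=> *; apply: Psi_def.
  - by have [] := nu0_eigen zeta xi.
  - by move=> th ths; have [] := nu_gen_eigen xi th ths.
  - by have [] := nu0_eigen j xi.
  - move=> jz D dD sD; apply: Psi_no_integral => //.
    by apply: contra jz => /eqP ->.
split=> // h X _ hsys F [oX _] Fdef FC; split=> // t x _ Xx.
(* Each summand vanishes separately: [lin_op (A j) F] is zero on [X] for every [j]. *)
apply: big1 => j _.
rewrite (@lin_op_eq0_generic _ _ (A j) X F [seq nu 0%N xi | xi <- enum 'I_r] x) //.
- by rewrite mulr0.
- by move=> c /mapP[xi _ ->]; have [] := nu0_eigen j xi.
move=> y Xy y0.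
have {}y0 xi : dotv (nu 0%N xi) y != 0.
  by apply: y0; apply: map_f; rewrite mem_enum.
rewrite /F.
(* The logarithmic derivative of the factor [xi] is the summand [xi] of equation [j] of the linear
   system, so over the whole product they add up to 0 by [hsys]. *)
have Fy (xi : 'I_r) : (xi < k)%N ->
  has_lin_op (A j) (fun y => rpow (dotv (nu 0%N xi) y) (h 0%N xi) *
    expR (\sum_(1 <= q < (eps xi).+1) h q xi * Psi q xi y)) y
    ((lam j xi * h 0%N xi + \sum_(1 <= q < (eps xi).+1)
       lin_op (A j) (Psi q xi) (nu 0%N xi) * h q xi) *
     (rpow (dotv (nu 0%N xi) y) (h 0%N xi) *
       expR (\sum_(1 <= q < (eps xi).+1) h q xi * Psi q xi y))).
  move=> xik.
  have h1 := has_lin_op_rpow_dotv (h 0%N xi) (nu0_eigen j xi).2 (y0 xi).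
  have h2 : has_lin_op (A j)
      (fun y => \sum_(q <- index_iota 1 (eps xi).+1) h q xi * Psi q xi y) y
      (\sum_(q <- index_iota 1 (eps xi).+1)
         lin_op (A j) (Psi q xi) (nu 0%N xi) * h q xi).
    apply: has_lin_op_sum => q; rewrite mem_index_iota => qeps.
    have rq : rational_form (nu 0%N xi) (Psi q xi).
      apply: (@rational_form_Psi _ _ (s xi) (nu^~ xi) (Psi^~ xi)).
        by move=> *; apply: Psi_def.
      exact: ltS.
    have := has_lin_opM (has_lin_op_cst (A j) (h q xi) y)
      (rational_form_has_lin_op (A j) rq (y0 xi)).
    by congr has_lin_op; rewrite mulr0 addr0 muE // mulrC.
  have := has_lin_opM h1 (has_lin_op_comp h2 (is_derive_expR _)).
  by congr has_lin_op; rewrite /=; ring.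
have [_ ->] := has_lin_op_prod Fy.
by rewrite hsys mul0r.
Qed.
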